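(* Let $G$ be a finite abelian group and let $K$ be a field containing an element of multiplicative order $|G|$. Let $\hat G$ be the group of characters (group homomorphisms) from $G$ to $K^*=K\setminus\{0\}$, let $k$ be a positive integer, and let $a_1,\ldots,a_k\in G$. Then $a_1,\ldots,a_k$ are pairwise distinct if and only if there are (distinct) $\chi_1,\ldots,\chi_k\in\hat G$ such that $\det(\chi_i(a_j))_{1\le i,j\le k}\neq 0$. Also, if $a_1,\ldots,a_k$ are pairwise distinct, then there exist $\chi_1,\ldots,\chi_k\in\hat G$ with $\mathrm{per}(\chi_i(a_j))_{1\le i,j\le k}\neq 0$.
   Context: For a $k\times k$ matrix $M=(m_{ij})$ over a commutative ring with identity, $\mathrm{per}(M)=\sum_{\sigma\in S_k}m_{1\sigma(1)}\cdots m_{k\sigma(k)}$ denotes the permanent of $M$, where $S_k$ is the symmetric group on $\{1,\ldots,k\}$. *)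

(* Defs.v *)
From HB Require Import structures.
From mathcomp Require Import all_boot all_order all_fingroup all_algebra.

Set Implicit Arguments.
Unset Strict Implicit.
Unset Printing Implicit Defensive.

Import GroupScope GRing.Theory.

Local Open Scope ring_scope.

Definition permanent (R : comPzRingType) (n : nat) (A : 'M[R]_n) : R :=
  \sum_(s : 'S_n) \prod_(i < n) A i (s i).

(* MathComp has no group structure on the nonzero elements of an arbitrary
   field, so a homomorphism from gT to K^* is encoded as a multiplicative,
   nowhere vanishing map from gT to K. *)
Definition is_group_character (gT : finGroupType) (K : fieldType)
    (f : {ffun gT -> K}) : bool :=
  [forall x, f x != 0] && [forall x, forall y, f (x * y)%g == f x * f y].

Record group_character (gT : finGroupType) (K : fieldType) := GroupCharacter {
  group_character_fun :> {ffun gT -> K};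
  _ : is_group_character group_character_fun
}.

HB.instance Definition _ (gT : finGroupType) (K : fieldType) :=
  [isSub for @group_character_fun gT K].
HB.instance Definition _ (gT : finGroupType) (K : fieldType) :=
  [Choice of group_character gT K by <:].

(* Main.v *)
Require Import Defs.
From HB Require Import structures.
From mathcomp Require Import all_boot all_order all_fingroup all_algebra.
From mathcomp Require Import all_field all_character.

Set Implicit Arguments.
Unset Strict Implicit.
Unset Printing Implicit Defensive.

Import GRing.Theory.

Local Open Scope ring_scope.

(** The determinant and the permanent of the matrix of the [chi i (a j)] are
    both of the form [\sum_s c s * \prod_i chi i (a (s i))], where [s] runs
    over the permutations and the coefficients [c s] are signs in the first
    case and ones in the second. For fixed [s], the product is multiplicative
    in the tuple [chi] of characters. When the [a j] are pairwise distinct,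
    different permutations give different multiplicative functions, because
    the characters of [gT] in [K] separate points ([character_separates]).
    Dedekind's independence theorem ([dedekind_independence]) then says that
    no nontrivial combination of these functions vanishes identically, so a
    suitable tuple exists for any nonzero [c] ([perm_expansion_neq0]); this
    covers both expansions, in every characteristic. The converse is the
    alternating property of the determinant, which also makes the characters
    of a nonsingular matrix distinct.

    Separation is known for complex characters: the irreducible characters of
    an abelian group are linear and their kernels meet trivially. Their values
    are powers of a primitive root of unity of order [#|gT|], and replacing
    this root by one in [K] turns them into characters with values in [K]. *)

(** Induction on the number of nonzero coefficients: two of the functions in
    the combination differ at some point [y], and translating by [y] gives a
    shorter combination. An abstract binary operation is used so that the
    result applies to tuples of characters under pointwise multiplication. The
    conclusion asserts a point where the combination is nonzero, rather than
    that a vanishing combination is trivial, because [T] may be infinite and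
    the point would then not follow constructively. *)
Lemma dedekind_independence (T : Type) (mul : T -> T -> T) (x0 : T)
    (I : finType) (K : fieldType) (f : I -> T -> K) :
    (forall i x, f i x != 0) ->
    (forall i x y, f i (mul x y) = f i x * f i y) ->
    (forall i j, i != j -> exists x, f i x != f j x) ->
  forall c : I -> K, (exists i, c i != 0) ->
  exists x, \sum_i c i * f i x != 0.
Proof.
move=> f_neq0 fM f_sep c; have [n] := ubnP #|[pred i | c i != 0]|.
elim: n c => // n IHn c; rewrite ltnS => le_c_n [i ci_neq0].
have [/existsP[j /andP[ji cj_neq0]] | /existsPn c_only_i] :=
  boolP [exists j, (j != i) && (c j != 0)]; last first.
  exists x0; rewrite (bigD1 i) //= big1 ?addr0 ?mulf_neq0 // => j ji.
  by have := c_only_i j; rewrite ji negbK => /eqP->; rewrite mul0r.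
have [|y fij] := f_sep i j; first by rewrite eq_sym.
(* Subtracting [f j y] times the relation at [x] from the relation at
   [mul y x] eliminates the term [j] and keeps the term [i]. *)
have [||x sum_neq0] := IHn (fun l => c l * (f l y - f j y)).
- apply: leq_trans le_c_n; apply/proper_card/properP; split.
    by apply/subsetP=> l; rewrite !inE mulf_eq0 => /norP[].
  by exists j; rewrite !inE // subrr mulr0 eqxx.
- by exists i; rewrite mulf_neq0 // subr_eq0.
have [sum_x0 | ] := eqVneq (\sum_l c l * f l x) 0; last by exists x.
exists (mul y x); apply: contraNneq sum_neq0 => sum_yx0.
rewrite (eq_bigr (fun l => c l * f l (mul y x) - f j y * (c l * f l x))).
  by rewrite sumrB -mulr_sumr sum_yx0 sum_x0 mulr0 subr0.
by move=> l _; rewrite fM mulrBr mulrBl !mulrA [f j y * _]mulrC.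
Qed.

Section GroupCharacters.

Variables (gT : finGroupType) (K : fieldType).
Implicit Types f g : group_character gT K.

Lemma group_character_neq0 f x : f x != 0.
Proof. by case: f => f /= /andP[/forallP]. Qed.

Lemma group_characterM f x y : f (x * y)%g = f x * f y.
Proof. by case: f => f /= /andP[_ /forallP/(_ x)/forallP/(_ y)/eqP]. Qed.

Fact group_character_one_subproof :
  is_group_character [ffun _ : gT => 1 : K].
Proof.
apply/andP; split; apply/forallP=> x; first by rewrite ffunE oner_neq0.
by apply/forallP=> y; rewrite !ffunE mulr1.
Qed.

Definition group_character_one := GroupCharacter group_character_one_subproof.

Fact group_character_mul_subproof f g :
  is_group_character [ffun x => f x * g x].
Proof.
apply/andP; split; apply/forallP=> x.
  by rewrite ffunE mulf_neq0 ?group_character_neq0.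
by apply/forallP=> y; rewrite !ffunE !group_characterM mulrACA.
Qed.

Definition group_character_mul f g :=
  GroupCharacter (group_character_mul_subproof f g).

(** A complex character of [gT] that distinguishes [x] from [y] is carried to
    [K] along the isomorphism [w ^+ n |-> z ^+ n] of the groups of roots of
    unity of order dividing [#|gT|]. *)
Lemma character_separates (z : K) (x y : gT) :
    abelian [set: gT] -> #|gT|.-primitive_root z -> x != y ->
  exists f : group_character gT K, f x != f y.
Proof.
move=> abG prim_z neq_xy.
have [w prim_w] : {w : algC | #|gT|.-primitive_root w}.
  by apply: C_prim_root_exists; apply: prim_order_gt0 prim_z.
have [i /negP ker_i] :
    exists i : Iirr [set: gT], ~~ ((x * y^-1)%g \in cfker 'chi_i).
  apply/existsP; rewrite -negb_forall; apply: contra neq_xy => /forallP ker_xy.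
  have /setP/(_ (x * y^-1)%g) := TI_cfker_irr [set: gT].
  rewrite eq_mulgV1 inE => <-; apply/bigcapP=> i _; exact: ker_xy.
have lin_i : 'chi_i \is a linear_char by apply/char_abelianP.
have chiM u v : 'chi_i (u * v)%g = 'chi_i u * 'chi_i v.
  by apply: lin_charM; rewrite ?inE.
have chi_root u : 'chi_i u ^+ #|gT| = 1.
  have /dvdnP[m ->] : (#[u]%g %| #|gT|)%N by rewrite -cardsT cardSg ?subsetT.
  by rewrite mulnC exprM lin_char_unity_root ?inE // expr1n.
pose n u : nat := sval (prim_rootP prim_w (chi_root u)).
have chiE u : 'chi_i u = w ^+ n u by rewrite /n; case: prim_rootP.
have w_to_z m1 m2 : (w ^+ m1 == w ^+ m2) = (z ^+ m1 == z ^+ m2).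
  by rewrite (eq_prim_root_expr prim_w) (eq_prim_root_expr prim_z).
have z_neq0 : z != 0.
  by rewrite (prim_root_eq0 prim_z) -lt0n (prim_order_gt0 prim_z).
have char_f : is_group_character [ffun u => z ^+ n u].
  apply/andP; split; apply/forallP=> u; first by rewrite ffunE expf_neq0.
  by apply/forallP=> v; rewrite !ffunE -exprD -w_to_z exprD -!chiE chiM.
exists (GroupCharacter char_f); rewrite /= !ffunE -w_to_z -!chiE.
apply/eqP=> eq_chi; apply: ker_i; rewrite cfkerEirr inE chiM eq_chi -chiM.
by rewrite mulgV.
Qed.

(** Dedekind's theorem for the functions
    [chi |-> \prod_i chi i (a (s i))] on tuples of characters, indexed by the
    permutations [s]. *)
Lemma perm_expansion_neq0 (z : K) (k : nat) (a : 'I_k -> gT) (c : 'S_k -> K) :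
    abelian [set: gT] -> #|gT|.-primitive_root z -> injective a ->
    (exists s, c s != 0) ->
  exists chi : 'I_k -> group_character gT K,
    \sum_s c s * \prod_i chi i (a (s i)) != 0.
Proof.
move=> abG prim_z a_inj; move: c.
apply: (@dedekind_independence ('I_k -> group_character gT K)
  (fun chi psi i => group_character_mul (chi i) (psi i))
  (fun=> group_character_one) 'S_k K (fun s chi => \prod_i chi i (a (s i)))).
- by move=> s chi; apply/prodf_neq0=> i _; apply: group_character_neq0.
- by move=> s chi psi; rewrite -big_split; apply: eq_bigr => i _; rewrite ffunE.
move=> s t neq_st.
have /existsP[i neq_i] : [exists i, s i != t i].
  rewrite -negb_forall; apply: contra neq_st => /forallP eq_st.
  by apply/eqP/permP=> i; apply/eqP.
have [|f neq_f] := @character_separates z (a (s i)) (a (t i)) abG prim_z.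
  by rewrite (inj_eq a_inj).
(* With trivial characters off the coordinate [i], the product is [f] there. *)
exists (fun j => if j == i then f else group_character_one).
suff prodE r : \prod_j (if j == i then f else group_character_one) (a (r j))
             = f (a (r i)) by rewrite !prodE.
rewrite (bigD1 i) //= eqxx big1 ?mulr1 // => j /negPf->.
by rewrite ffunE.
Qed.

End GroupCharacters.

Theorem lemma3p1 (gT : finGroupType) (abG : abelian [set: gT])
    (K : fieldType) (hK : exists z : K, #|gT|.-primitive_root z)
    (k : nat) (k_gt0 : (0 < k)%N) (a : 'I_k -> gT) :
  (injective a <->
    exists chi : 'I_k -> group_character gT K,
      injective chi /\
      \det (\matrix_(i < k, j < k) chi i (a j)) != 0) /\
  (injective a ->
    exists chi : 'I_k -> group_character gT K,
      permanent (\matrix_(i < k, j < k) chi i (a j)) != 0).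
Proof.
have [z prim_z] := hK; split; first split.
- move=> a_inj.
  have [|chi chi_neq0] := perm_expansion_neq0
    (c := fun s : 'S_k => (-1) ^+ s) abG prim_z a_inj.
    by exists 1%g; rewrite signr_eq0.
  have det_neq0 : \det (\matrix_(i < k, j < k) chi i (a j)) != 0.
    apply: contraNneq chi_neq0 => det0; rewrite -[X in _ == X]det0; apply/eqP.
    apply: eq_bigr => s _; congr (_ * _).
    by apply: eq_bigr => i _; rewrite mxE.
  exists chi; split=> // i j eq_chi; apply: contraNeq det_neq0 => neq_ij.
  apply/eqP/(determinant_alternate neq_ij) => l.
  by rewrite !mxE eq_chi.
- case=> chi [_ det_neq0] i j eq_a; apply: contraNeq det_neq0 => neq_ij.
  rewrite -det_tr; apply/eqP/(determinant_alternate neq_ij) => l.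
  by rewrite !mxE eq_a.
move=> a_inj.
have [|chi chi_neq0] := perm_expansion_neq0
  (c := fun=> 1) abG prim_z a_inj.
  by exists 1%g; rewrite oner_neq0.
exists chi; apply: contraNneq chi_neq0 => per0; rewrite -[X in _ == X]per0.
apply/eqP/eq_bigr => s _; rewrite mul1r.
by apply: eq_bigr => i _; rewrite mxE.
Qed.
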